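(* Let $V$ be a vertex Leibniz algebra. Then $V$ admits a faithful module if and only if $V$ is a vertex Leibniz subalgebra of some vertex algebra. In particular, if the vertex operator map $Y(\cdot,x)$ of $V$ is injective, i.e., for any nonzero $u\in V$ there exists $v\in V$ such that $Y(u,x)v\neq0$, then $V$ is a vertex Leibniz subalgebra of some vertex algebra.
   Context: All vector spaces are over $\mathbb{C}$. $V((x))$ denotes the space of lower truncated formal Laurent series, $\delta(x)=\sum_{n\in\mathbb{Z}}x^n$, and powers $(x\pm y)^n$ are expanded in nonnegative integer powers of the second variable $y$. A vertex Leibniz algebra is a vector space $V$ with a linear map $Y(\cdot,x):V\to\mathrm{Hom}(V,V((x)))$, $v\mapsto Y(v,x)=\sum_{n\in\mathbb{Z}}v_nx^{-n-1}$, such that for all $u,v\in V$ the Jacobi identity holds: $$x_0^{-1}\delta\left(\tfrac{x_1-x_2}{x_0}\right)Y(u,x_1)Y(v,x_2)-x_0^{-1}\delta\left(\tfrac{x_2-x_1}{-x_0}\right)Y(v,x_2)Y(u,x_1)=x_2^{-1}\delta\left(\tfrac{x_1-x_0}{x_2}\right)Y(Y(u,x_0)v,x_2).$$ A (faithful) $V$-module is a vector space $W$ with an (injective) linear map $Y_W(\cdot,x):V\to\mathrm{Hom}(W,W((x)))$ such that for all $u,v\in V$ $$x_0^{-1}\delta\left(\tfrac{x_1-x_2}{x_0}\right)Y_W(u,x_1)Y_W(v,x_2)-x_0^{-1}\delta\left(\tfrac{x_2-x_1}{-x_0}\right)Y_W(v,x_2)Y_W(u,x_1)=x_2^{-1}\delta\left(\tfrac{x_1-x_0}{x_2}\right)Y_W(Y(u,x_0)v,x_2).$$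 A vertex algebra is a vertex Leibniz algebra $K$ with a vector $\mathbf 1\in K$ such that $Y(\mathbf 1,x)v=v$, $Y(v,x)\mathbf 1\in K[[x]]$ and $\lim_{x\to0}Y(v,x)\mathbf 1=v$ for all $v\in K$. A vertex Leibniz subalgebra of $K$ is a subspace closed under all products $a_nb$, $n\in\mathbb Z$, with the restricted map $Y$; ''$V$ is a vertex Leibniz subalgebra of some vertex algebra'' is meant up to isomorphism, i.e. there is a vertex algebra $K$ and an injective linear map $\psi:V\to K$ with $\psi(Y(u,x)v)=Y(\psi(u),x)\psi(v)$ for $u,v\in V$. *)

(* Defs.v *)
From HB Require Import structures.
From mathcomp Require Import all_boot all_order all_algebra.
From mathcomp Require Import complex.
From mathcomp Require Import all_classical reals.

Set Implicit Arguments.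
Unset Strict Implicit.
Unset Printing Implicit Defensive.

Import Order.TTheory GRing.Theory Num.Theory.
Local Open Scope ring_scope.

Section FormalSeries.
Variable F : numFieldType.

(* [f (a, b, c)] is the coefficient of x0^a x1^b x2^c. *)
Definition fseries3 (U : Type) := int * int * int -> U.

(* The coefficient of [f * g] at [e] is the sum of all [f d *: g (e - d)].
   The infinite-range [\sum_(_ \in _)] is 0 when the family does not have
   finite support. In [jacobi_identity] below the support is always finite,
   as the fields involved are lower truncated. *)
Definition fseries3_mul (U : lmodType F) (f : fseries3 F) (g : fseries3 U) :
    fseries3 U :=
  fun e => \sum_(d \in [set: int * int * int]%classic) f d *: g (e - d).

Definition binomz (n : int) (k : nat) : F :=
  (\prod_(j < k) (n%:~R - j%:R)) / k`!%:R.

(* Coefficient of x^i y^j in (x - y)^n, expanded in nonnegative powers of y. *)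
Definition coef_subX (n i j : int) : F :=
  if (0 <= j) && (i + j == n) then (-1) ^+ `|j|%N * binomz n `|j|%N else 0.

(* x0^-1 delta((x1 - x2) / x0) = \sum_n x0^(-n-1) (x1 - x2)^n *)
Definition delta_12_0 : fseries3 F :=
  fun '(a, b, c) => coef_subX (- a - 1) b c.

(* x0^-1 delta((x2 - x1) / - x0) = \sum_n (-1)^n x0^(-n-1) (x2 - x1)^n *)
Definition delta_21_0 : fseries3 F :=
  fun '(a, b, c) => (-1) ^ (- a - 1) * coef_subX (- a - 1) c b.

(* x2^-1 delta((x1 - x0) / x2) = \sum_n x2^(-n-1) (x1 - x0)^n *)
Definition delta_10_2 : fseries3 F :=
  fun '(a, b, c) => coef_subX (- c - 1) b a.

End FormalSeries.

Section VertexLeibniz.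
Variable F : numFieldType.

(* A candidate for a map V -> Hom(W, W((x))), given by its modes:
   Y(v, x) w = \sum_n Y v n w x^(-n-1), i.e., [Y v n w] is v_n w, and the
   coefficient of x^a in Y(v, x) w is [Y v (- a - 1) w]. *)
Definition modes (V W : Type) := V -> int -> W -> W.

Definition is_vertex_map (V W : lmodType F) (Y : modes V W) : Prop :=
  [/\ forall n w, linear (fun v => Y v n w),
      forall v n, linear (Y v n)
    & forall v w, exists N : int, forall n : int, N <= n -> Y v n w = 0].

(* Y(u, x1) Y(v, x2) w *)
Definition prod_12 (V W : lmodType F) (Y : modes V W) (u v : V) (w : W) :
    fseries3 W :=
  fun '(a, b, c) => if a == 0 then Y u (- b - 1) (Y v (- c - 1) w) else 0.

(* Y(v, x2) Y(u, x1) w *)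
Definition prod_21 (V W : lmodType F) (Y : modes V W) (u v : V) (w : W) :
    fseries3 W :=
  fun '(a, b, c) => if a == 0 then Y v (- c - 1) (Y u (- b - 1) w) else 0.

(* YW(Y(u, x0) v, x2) w *)
Definition iterate_02 (V W : lmodType F) (Y : modes V V) (YW : modes V W)
    (u v : V) (w : W) : fseries3 W :=
  fun '(a, b, c) => if b == 0 then YW (Y u (- a - 1) v) (- c - 1) w else 0.

Definition jacobi_identity (V W : lmodType F) (Y : modes V V)
    (YW : modes V W) : Prop :=
  forall (u v : V) (w : W) (e : int * int * int),
    fseries3_mul (@delta_12_0 F) (prod_12 YW u v w) e
    - fseries3_mul (@delta_21_0 F) (prod_21 YW u v w) e
    = fseries3_mul (@delta_10_2 F) (iterate_02 Y YW u v w) e.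

Definition is_vertex_leibniz (V : lmodType F) (Y : modes V V) : Prop :=
  is_vertex_map Y /\ jacobi_identity Y Y.

Definition is_module (V W : lmodType F) (Y : modes V V) (YW : modes V W) :
    Prop :=
  is_vertex_map YW /\ jacobi_identity Y YW.

Definition is_faithful_module (V W : lmodType F) (Y : modes V V)
    (YW : modes V W) : Prop :=
  is_module Y YW /\ injective YW.

Definition is_vertex_algebra (K : lmodType F) (Y : modes K K) (one : K) :
    Prop :=
  [/\ is_vertex_leibniz Y,
      forall n v, Y one n v = if n == -1 then v else 0,
      forall v (n : int), 0 <= n -> Y v n one = 0
    & forall v, Y v (-1) one = v].

Definition admits_faithful_module (V : lmodType F) (Y : modes V V) : Prop :=
  exists (W : lmodType F) (YW : modes V W), is_faithful_module Y YW.

Definition embeds_in_vertex_algebra (V : lmodType F) (Y : modes V V) : Prop :=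
  exists (K : lmodType F) (YK : modes K K) (one : K),
    is_vertex_algebra YK one /\
    exists psi : {linear V -> K},
      injective psi /\
      forall (u v : V) (n : int), psi (Y u n v) = YK (psi u) n (psi v).

End VertexLeibniz.

(* Main.v *)
(** Write Y_W(v, x) for the action of V on a faithful module W. The fields on W
    spanned by the identity field and the derivatives of the Y_W(v, x) are
    closed under all n-th products of fields, because
    Y_W(u, x)_n Y_W(v, x) = Y_W(u_n v, x), and they form the vertex algebra.

    For fixed u, v, w, each of the three terms of the Jacobi identity is, as a
    family indexed by the monomials x1^m (x1 - x2)^k x2^l, the only solution
    of the recurrence J(m+1,k,l) = J(m,k,l+1) + J(m,k+1,l) that vanishes for
    large l, m or k respectively and has prescribed values on a plane (k = 0,
    k = 0, m = 0). Derivatives therefore pass through the Jacobi identity in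
    each of its three arguments, and only triples of generators remain: those
    without the identity come from V, an identity in one of the first two slots
    makes the two products commute, and the triple (u, v, 1) follows from
    skew symmetry and the recurrence. *)

From HB Require Import structures.
From mathcomp Require Import all_boot all_order all_algebra.
From mathcomp Require Import complex ring zify.
From mathcomp Require Import all_classical reals.
Require Import Defs.

Set Implicit Arguments.
Unset Strict Implicit.
Unset Printing Implicit Defensive.

Import Order.TTheory GRing.Theory Num.Theory.
Local Open Scope ring_scope.

(** * Linear identities in a module, decided by comparing coefficients *)

Section LinearCombinations.
Variables (F : comPzRingType) (M : lmodType F).

Inductive lincomb :=
  | LVar of nat | LZero | LAdd of lincomb & lincomb | LOpp of lincomb
  | LScale of F & lincomb.

Fixpoint lin_eval (env : seq M) (e : lincomb) : M :=
  match e with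
  | LVar i => env`_i
  | LZero => 0
  | LAdd e1 e2 => lin_eval env e1 + lin_eval env e2
  | LOpp e1 => - lin_eval env e1
  | LScale c e1 => c *: lin_eval env e1
  end.

(* [Nat.eqb], unlike [==], is computed by [/=]. *)
Fixpoint lin_coef (j : nat) (e : lincomb) : F :=
  match e with
  | LVar i => if PeanoNat.Nat.eqb i j then 1 else 0
  | LZero => 0
  | LAdd e1 e2 => lin_coef j e1 + lin_coef j e2
  | LOpp e1 => - lin_coef j e1
  | LScale c e1 => c * lin_coef j e1
  end.

Fixpoint lin_wf (n : nat) (e : lincomb) : bool :=
  match e with
  | LVar i => (i < n)%N
  | LZero => true
  | LAdd e1 e2 => lin_wf n e1 && lin_wf n e2
  | LOpp e1 => lin_wf n e1
  | LScale c e1 => lin_wf n e1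
  end.

Lemma lin_evalE env e : lin_wf (size env) e ->
  lin_eval env e = \sum_(j < size env) lin_coef j e *: env`_j.
Proof.
elim: e => [i|_|e1 IH1 e2 IH2|e IH|c e IH] /=.
- move=> lti; rewrite (bigD1 (Ordinal lti)) //= PeanoNat.Nat.eqb_refl scale1r.
  rewrite big1 ?addr0 // => j /eqP ji.
  case: PeanoNat.Nat.eqb_spec => [eji|_]; last exact: scale0r.
  by case: ji; apply: val_inj.
- by rewrite big1 // => j _; rewrite scale0r.
- move=> /andP[w1 w2]; rewrite IH1 // IH2 // -big_split /=.
  by apply: eq_bigr => j _; rewrite scalerDl.
- by move=> w; rewrite IH // -sumrN; apply: eq_bigr => j _; rewrite scaleNr.
- by move=> w; rewrite IH // scaler_sumr; apply: eq_bigr => j _;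
    rewrite scalerA.
Qed.

(** A nested conjunction instead of a bounded quantifier, so that [/=] and [split] leave one scalar
    equation per vector. *)
Fixpoint all_coef (n : nat) (e1 e2 : lincomb) : Prop :=
  if n is n'.+1 then all_coef n' e1 e2 /\ lin_coef n' e1 = lin_coef n' e2
  else True.

Lemma lin_eval_eq env e1 e2 :
  lin_wf (size env) e1 && lin_wf (size env) e2 ->
  all_coef (size env) e1 e2 -> lin_eval env e1 = lin_eval env e2.
Proof.
move=> /andP[w1 w2] E; rewrite !lin_evalE //; apply: eq_bigr => j _.
suff -> : lin_coef j e1 = lin_coef j e2 by [].
move: (size env) (nat_of_ord j) (ltn_ord j) E => n i; elim: n => //= n IH.
rewrite ltnS leq_eqVlt => /orP[/eqP ->|/IH E'] [E1 E2] //; exact: E'.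
Qed.

End LinearCombinations.

Ltac lin_index x env :=
  lazymatch env with
  | x :: _ => constr:(O)
  | _ :: ?env' => let i := lin_index x env' in constr:(S i)
  end.

Ltac lin_mem x env :=
  lazymatch env with
  | nil => constr:(false)
  | x :: _ => constr:(true)
  | _ :: ?env' => lin_mem x env'
  end.

Ltac lin_env t env :=
  lazymatch t with
  | (?a + ?b)%R => let env' := lin_env a env in lin_env b env'
  | (- ?a)%R => lin_env a env
  | (_ *: ?a)%R => lin_env a env
  | 0%R => env
  | _ => let b := lin_mem t env in
         lazymatch b with true => env | false => constr:(t :: env) end
  end.

Ltac lin_reify F t env :=
  lazymatch t with
  | (?a + ?b)%R => let a' := lin_reify F a env in let b' := lin_reify F b env in
                   constr:(@LAdd F a' b')
  | (- ?a)%R => let a' := lin_reify F a env in constr:(@LOpp F a')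
  | (?c *: ?a)%R => let a' := lin_reify F a env in constr:(@LScale F c a')
  | 0%R => constr:(@LZero F)
  | _ => let i := lin_index t env in constr:(@LVar F i)
  end.

(* Reduces an equality of linear combinations over [F] to the equality of the
   coefficients of each vector. *)
Ltac lin_module F :=
  lazymatch goal with
  | |- @eq ?T ?l ?r =>
    let env0 := lin_env l (@nil T) in
    let env := lin_env r env0 in
    let l' := lin_reify F l env in
    let r' := lin_reify F r env in
    change (lin_eval env l' = lin_eval env r');
    apply: lin_eval_eq; [by []|rewrite /=; do ?split]
  end.

(** * Binomial coefficients with an integer upper index *)

Section Binomial.
Variable F : numFieldType.
Implicit Types (n m : int) (k i : nat).

Lemma binomz_n0 n : binomz F n 0 = 1.
Proof. by rewrite /binomz big_ord0 fact0 divr1. Qed.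

Lemma binomz_0S k : binomz F 0 k.+1 = 0.
Proof. by rewrite /binomz big_ord_recl /= subrr mul0r mul0r. Qed.

Lemma factS_neq0 k : (k.+1%:R : F) != 0 /\ (k`!%:R : F) != 0.
Proof. by rewrite !pnatr_eq0 -!lt0n fact_gt0. Qed.

Lemma binomzS_mul n k :
  k.+1%:R * binomz F n k.+1 = (n%:~R - k%:R) * binomz F n k.
Proof.
rewrite /binomz big_ord_recr /= factS natrM.
by have [k0 f0] := factS_neq0 k; field; rewrite nat1r k0 f0.
Qed.

Lemma binomz_absorb n k :
  k.+1%:R * binomz F (n + 1) k.+1 = (n%:~R + 1) * binomz F n k.
Proof.
rewrite /binomz big_ord_recl /= factS natrM subr0.
have -> : \prod_(i < k) ((n + 1)%:~R - (bump 0 i)%:R) =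
          \prod_(i < k) (n%:~R - i%:R) :> F.
  by apply: eq_bigr => i _; rewrite /bump /= add1n intrD -natr1; ring.
rewrite intrD.
by have [k0 f0] := factS_neq0 k; field; rewrite nat1r k0 f0.
Qed.

Lemma binomzSS n k :
  binomz F (n + 1) k.+1 = binomz F n k.+1 + binomz F n k.
Proof.
have [k0 _] := factS_neq0 k.
apply: (mulfI k0); rewrite binomz_absorb mulrDr binomzS_mul -natr1; ring.
Qed.

Lemma binomz_m1 k : binomz F (- 1) k = (- 1) ^+ k.
Proof.
elim: k => [|k IH]; first by rewrite binomz_n0.
have [k0 _] := factS_neq0 k.
apply: (mulfI k0); rewrite binomzS_mul IH -natr1 exprS; ring.
Qed.

(** Upper negation: once the order of the k factors is reversed, each factor is the negative of the
    matching factor on the other side. *)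
Lemma binomz_neg m k :
  (- 1) ^+ k * binomz F (k%:Z - m - 1) k = binomz F m k.
Proof.
rewrite /binomz mulrA; congr (_ / _).
rewrite -[X in (- 1) ^+ X]card_ord -prodr_const -big_split /=.
rewrite (reindex_inj rev_ord_inj) /=; apply: eq_bigr => i _.
have -> : (k - i.+1)%N%:R = k%:R - i%:R - 1 :> F.
  by rewrite natrB // -natr1; ring.
by rewrite !rmorphB /=; ring.
Qed.

End Binomial.

(** * Expansions of (al y + be x)^n applied to truncated families *)

Section Expansion.
Variables (F : numFieldType) (M : lmodType F).
Implicit Types (n p q N : int) (G H : int -> int -> M).

Definition truncated G := exists N : int, forall p q, N <= p -> G p q = 0.

Definition expand_coef (al be : F) n (i : nat) : F :=
  al ^ (n - i%:Z) * be ^+ i * binomz F n i.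

(* Coefficients of the expansion of (al y + be x)^n in nonnegative powers of
   x, applied to the family [G] of coefficients of x^p y^q. *)
Definition expand (al be : F) G n p q : M :=
  \sum_(i \in [set: nat]%classic)
    expand_coef al be n i *: G (p + i%:Z) (q + n - i%:Z).

Lemma expandE al be G n p q N m :
  (forall p q, N <= p -> G p q = 0) -> N <= p + m%:Z ->
  expand al be G n p q =
    \sum_(i < m) expand_coef al be n i *: G (p + i%:Z) (q + n - i%:Z).
Proof.
move=> GN Nm; rewrite /expand.
rewrite (@fsbig_ord _ _ _ m
  (fun i => expand_coef al be n i *: G (p + i%:Z) (q + n - i%:Z))).
apply/esym/fsbig_widen => // i /= [_ /negP]; rewrite -leqNgt => mi.
by rewrite GN ?scaler0 //; lia.
Qed.

(** One cutoff serves all n, q, al, be and all p' >= p, so that several expansions can be compared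
    over a common finite range. *)
Lemma expand_bound G p : truncated G ->
  exists m : nat, forall m' p' q n al be, (m <= m')%N -> p <= p' ->
   expand al be G n p' q =
    \sum_(i < m') expand_coef al be n i *: G (p' + i%:Z) (q + n - i%:Z).
Proof.
move=> [N GN]; exists `|N - p|%N => m' p' q n al be mm' pp'.
by apply: expandE GN _; lia.
Qed.

Lemma expand_coef0 al be n : expand_coef al be n 0 = al ^ n.
Proof. by rewrite /expand_coef expr0 binomz_n0 subr0 !mulr1. Qed.

Lemma expand_coef_pascal al be n i : al != 0 ->
  expand_coef al be (n + 1) i.+1 =
  al * expand_coef al be n i.+1 + be * expand_coef al be n i.
Proof.
move=> al0; rewrite /expand_coef binomzSS exprS.
have -> : n + 1 - i.+1%:Z = n - i%:Z by lia.
have -> : n - i%:Z = (n - i.+1%:Z) + 1 by lia.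
by rewrite expfzDr // expr1z; ring.
Qed.

(** One more factor al y + be x is multiplied out: y shifts q and x shifts p. On coefficients this
    is Pascal's rule. *)
Lemma expand_rec al be G n p q : al != 0 -> truncated G ->
  expand al be G (n + 1) p q =
  al *: expand al be G n p (q + 1) + be *: expand al be G n (p + 1) q.
Proof.
move=> al0 tG; have [m Em] := expand_bound p tG.
(* The expansion at p + 1 is cut one term earlier, so that its terms match the tails of the other
   two. *)
rewrite (Em m.+1) ?(Em m (p + 1)) ?(Em m.+1 p (q + 1)); try lia.
rewrite !scaler_sumr [LHS]big_ord_recl [in RHS]big_ord_recl -[RHS]addrA.
congr (_ + _).
  rewrite !expand_coef0 scalerA expfzDr // expr1z mulrC.
  by congr (_ *: G _ _); lia.
rewrite -big_split /=; apply: eq_bigr => i _.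
rewrite expand_coef_pascal // scalerDl !scalerA.
by congr (_ *: G _ _ + _ *: G _ _); rewrite /bump leq0n add1n; lia.
Qed.

Lemma expand0 al be G p q : truncated G -> expand al be G 0 p q = G p q.
Proof.
move=> tG; have [m Em] := expand_bound p tG.
rewrite (Em m.+1) ?leqnSn //.
rewrite big_ord_recl expand_coef0 expr0z scale1r big1 ?addr0.
  by congr (G _ _); lia.
by move=> i _; rewrite /expand_coef binomz_0S mulr0 scale0r.
Qed.

Lemma expand_eq0 al be G n p q N : (forall p q, N <= p -> G p q = 0) ->
  N <= p -> expand al be G n p q = 0.
Proof.
by move=> GN Np; rewrite (@expandE _ _ _ _ _ _ N 0) ?big_ord0 //; lia.
Qed.

Lemma expand_const0 al be n p q :
  expand al be (fun _ _ : int => 0 : M) n p q = 0.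
Proof. exact: (@expand_eq0 _ _ _ _ _ _ p). Qed.

Lemma int_up_ind (P : int -> Prop) (a : int) :
  P a -> (forall n, a <= n -> P n -> P (n + 1)) -> forall n, a <= n -> P n.
Proof.
move=> P0 PS n an; have -> : n = a + `|n - a|%N%:Z by lia.
elim: `|n - a|%N => [|k IH]; first by rewrite addr0.
have -> : a + k.+1%:Z = (a + k%:Z) + 1 by lia.
by apply: PS => //; lia.
Qed.

Lemma int_down_ind (P : int -> Prop) (a : int) :
  P a -> (forall n, n < a -> P (n + 1) -> P n) -> forall n, n <= a -> P n.
Proof.
move=> P0 PS n na; have -> : n = a - `|a - n|%N%:Z by lia.
elim: `|a - n|%N => [|k IH]; first by rewrite subr0.
apply: PS; first lia.
by have -> : a - k.+1%:Z + 1 = a - k%:Z by lia.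
Qed.

(** The plane n = 0 determines larger n directly. For n < 0 the recurrence is solved for its [al]
    term, which expresses the value at (n, p, q) by those at (n + 1, p, q - 1) and (n, p + 1, q -
    1); hence the inner descending induction on p from N. *)
Lemma expansion_rec0 (P : int -> int -> int -> M) (al be : F) N :
  al != 0 ->
  (forall n p q, P (n + 1) p q = al *: P n p (q + 1) + be *: P n (p + 1) q) ->
  (forall p q, P 0 p q = 0) -> (forall n p q, N <= p -> P n p q = 0) ->
  forall n p q, P n p q = 0.
Proof.
move=> al0 PS P0 PN n.
case: (leP 0 n) => [n0|/ltW n0].
  move: n n0; apply: int_up_ind => // n _ IH p q.
  by rewrite PS !IH !scaler0 addr0.
move: n n0; apply: int_down_ind => // n _ IH p.
case: (leP N p) => [Np q|/ltW pN]; first exact: PN.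
move: p pN; apply: int_down_ind => [q|p _ IHp q]; first exact: PN.
have := PS n p (q - 1); rewrite IH IHp scaler0 addr0 subrK => /esym/eqP.
by rewrite scaler_eq0 (negPf al0) => /eqP.
Qed.

(** The difference of two solutions falls under [expansion_rec0]. The derivative and sign rules
    below check the recurrence, the plane n = 0 and the vanishing instead of manipulating binomial
    sums. *)
Lemma expand_uniq (P : int -> int -> int -> M) (al be : F) G N :
  al != 0 ->
  (forall n p q, P (n + 1) p q = al *: P n p (q + 1) + be *: P n (p + 1) q) ->
  (forall p q, P 0 p q = G p q) -> (forall n p q, N <= p -> P n p q = 0) ->
  forall n p q, expand al be G n p q = P n p q.
Proof.
move=> al0 PS P0 PN.
have GN p q : N <= p -> G p q = 0 by move=> Np; rewrite -P0 PN.
have tG : truncated G by exists N.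
suff H n p q : expand al be G n p q - P n p q = 0.
  by move=> n p q; apply/subr0_eq/H.
apply: (@expansion_rec0 (fun n p q => expand al be G n p q - P n p q) al be N)
  => // [{}n {}p {}q|{}p {}q|{}n {}p {}q Np].
- by rewrite expand_rec // PS !scalerBr opprD addrACA.
- by rewrite expand0 // P0 subrr.
- by rewrite PN // subr0 (expand_eq0 _ _ _ _ GN).
Qed.

(** Integration by parts. If G p q is the residue of x^p y^q g(x, y), then - q G p (q - 1) is that
    of x^p y^q times the y-derivative of g; the last term comes from differentiating (al y + be
    x)^n. *)
Lemma expand_derivq al be G n p q : al != 0 -> truncated G ->
  expand al be (fun p q => - q%:~R *: G p (q - 1)) n p q =
  - q%:~R *: expand al be G n p (q - 1)
  - (al * n%:~R) *: expand al be G (n - 1) p q.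
Proof.
move=> al0 tG; have [N GN] := tG; move: n p q.
apply: (expand_uniq (N := N) al0) => [n p q|p q|n p q Np]; last first.
- by rewrite !(expand_eq0 _ _ _ _ GN) // !scaler0 subr0.
- by rewrite expand0 // mulr0 scale0r subr0.
have R1 := expand_rec be n p (q - 1) al0 tG.
have R2 := expand_rec be (n - 1) p q al0 tG.
rewrite subrK in R1; rewrite subrK in R2.
rewrite !addrK R1 R2 intrD ?subrK.
lin_module F; ring.
Qed.

Lemma expand_derivp al be G n p q : al != 0 -> truncated G ->
  expand al be (fun p q => - p%:~R *: G (p - 1) q) n p q =
  - p%:~R *: expand al be G n (p - 1) q
  - (be * n%:~R) *: expand al be G (n - 1) p q.
Proof.
move=> al0 tG; have [N GN] := tG; move: n p q.
apply: (expand_uniq (N := N + 1) al0) => [n p q|p q|n p q Np]; last first.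
- by rewrite !(expand_eq0 _ _ _ _ GN) ?scaler0 ?subr0 //; lia.
- by rewrite expand0 // mulr0 scale0r subr0.
have R1 := expand_rec be n (p - 1) q al0 tG.
have R2 := expand_rec be (n - 1) p q al0 tG.
rewrite subrK in R1; rewrite subrK in R2.
rewrite !addrK R1 R2 intrD.
lin_module F; ring.
Qed.

Lemma expand_lin al be G H c n p q : truncated G -> truncated H ->
  expand al be (fun p q => c *: G p q + H p q) n p q =
  c *: expand al be G n p q + expand al be H n p q.
Proof.
move=> [N GN] [N' HN].
have GM p' q' : Num.max N N' <= p' -> G p' q' = 0.
  by rewrite ge_max => /andP[+ _]; apply: GN.
have HM p' q' : Num.max N N' <= p' -> H p' q' = 0.
  by rewrite ge_max => /andP[_]; apply: HN.
have NM : Num.max N N' <= p + `|Num.max N N' - p|%N%:Z by lia.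
rewrite (expandE _ _ _ _ GM NM) (expandE _ _ _ _ HM NM) (expandE _ _ _ _ _ NM).
  rewrite scaler_sumr -big_split /=; apply: eq_bigr => i _.
  by lin_module F; ring.
by move=> p' q' h; rewrite (GM _ _ h) (HM _ _ h) scaler0 addr0.
Qed.

Lemma eq_expand al be G H : (forall p q, G p q = H p q) ->
  expand al be G = expand al be H.
Proof. by move=> GH; congr expand; apply/funext => p; apply/funext => q. Qed.

Lemma expandN al be G n p q : al != 0 -> truncated G ->
  expand (- al) (- be) G n p q = (- 1) ^ n *: expand al be G n p q.
Proof.
move=> al0 tG; have [N GN] := tG; move: n p q.
have Nal0 : - al != 0 by rewrite oppr_eq0.
have m10 : (- 1 : F) != 0 by rewrite oppr_eq0 oner_eq0.
apply: (expand_uniq (N := N) Nal0) => [n p q|p q|n p q Np].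
- rewrite expand_rec // expfzDr // expr1z.
  by lin_module F; ring.
- by rewrite expand0 // expr0z scale1r.
- by rewrite (expand_eq0 _ _ _ _ GN) // scaler0.
Qed.

End Expansion.

Lemma expand_map (F : numFieldType) (M M' : lmodType F) (f : {linear M -> M'})
    (al be : F) (G : int -> int -> M) n p q : truncated G ->
  expand al be (fun p q => f (G p q)) n p q = f (expand al be G n p q).
Proof.
move=> tG; have [m E] := expand_bound p tG; rewrite (E m) //.
have [N GN] := tG.
have NM : N <= p + `|N - p|%N%:Z by lia.
rewrite -(E m) // (expandE _ _ _ _ GN NM) (expandE _ _ _ _ _ NM).
  by rewrite linear_sum; apply: eq_bigr => i _; rewrite linearZ.
by move=> p' q' /GN ->; rewrite linear0.
Qed.

(** * The Jacobi identity in modes *)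

Section Borcherds.
Variables (F : numFieldType).

Section Trilinear.
Variable M : lmodType F.
Implicit Types A B C : int -> int -> M.

(* Residues of x1^m (x1 - x2)^k x2^l against the three terms of the Jacobi
   identity, where [A m l], [B m l] and [C k l] stand for a_m (b_l c),
   b_l (a_m c) and (a_k b)_l c. *)
Definition res12 A (m k l : int) : M := expand 1 (- 1) (fun l m => A m l) k l m.
Definition res21 B (m k l : int) : M := expand (- 1) 1 B k m l.
Definition res02 C (m k l : int) : M := expand 1 1 C m k l.

Definition borcherds A B C :=
  forall m k l, res12 A m k l - res21 B m k l = res02 C m k l.

End Trilinear.

(** A delta function times a series lacking one variable leaves a single free exponent; this turns
    the sum over exponent triples into the sum defining [expand]. *)
Lemma fsum_inj (M : lmodType F) (h : nat -> int * int * int)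
    (f : int * int * int -> M) :
  injective h -> (forall d, f d <> 0 -> exists i, h i = d) ->
  \sum_(d \in [set: int * int * int]%classic) f d =
  \sum_(i \in [set: nat]%classic) f (h i).
Proof.
move=> hI fh; rewrite -(@fsbig_image _ _ _ _ _ [set: nat]%classic h f);
  last exact: (in2W hI).
apply/esym/fsbig_widen => // d [_ /= nd].
by apply: contrapT => /fh [i hi]; apply: nd; exists i.
Qed.

Lemma fseries3_mul_12 (V W : lmodType F) (YW : modes V W) u v w a b c :
  fseries3_mul (@delta_12_0 F) (prod_12 YW u v w) (a, b, c) =
  res12 (fun m l => YW u m (YW v l w)) (- b - 1) (- a - 1) (- c - 1).
Proof.
(* The product has no x0, which fixes the exponent a of the kernel; the degree - a - 1 then fixes
   the exponent of x1 once that of x2 is i. *)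
rewrite /fseries3_mul (@fsum_inj _ (fun i => (a, - a - 1 - i%:Z, i%:Z))).
- rewrite /res12 /expand; apply: eq_fsbigr => i _ /=.
  rewrite /coef_subX /expand_coef subrr eqxx exp1rz mul1r absz_nat.
  rewrite subrK eqxx andbT /=; congr (_ *: YW u _ (YW v _ w)); lia.
- by move=> i j [].
- move=> [[a' b'] c'] /=; rewrite /coef_subX.
  have [aa'|_] := eqVneq (a - a') 0; last by rewrite scaler0.
  case: andP => [[c0 /eqP e]|_]; last by rewrite scale0r.
  by move=> _; exists `|c'|%N; congr (_, _, _); lia.
Qed.

Lemma fseries3_mul_21 (V W : lmodType F) (YW : modes V W) u v w a b c :
  fseries3_mul (@delta_21_0 F) (prod_21 YW u v w) (a, b, c) =
  res21 (fun m l => YW v l (YW u m w)) (- b - 1) (- a - 1) (- c - 1).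
Proof.
rewrite /fseries3_mul (@fsum_inj _ (fun i => (a, i%:Z, - a - 1 - i%:Z))).
- rewrite /res21 /expand; apply: eq_fsbigr => i _ /=.
  rewrite /coef_subX /expand_coef subrr eqxx absz_nat subrK eqxx andbT /=.
  congr (_ *: YW v _ (YW u _ w)); [|lia|lia].
  rewrite expr1n mulr1 mulrA; congr (_ * _).
  have m10 : (- 1 : F) != 0 by rewrite oppr_eq0 oner_eq0.
  (* Since -1 is its own inverse, the sign (-1)^i of the kernel is (-1)^(-i), as in the power n - i
     of al = -1. *)
  by rewrite [RHS]expfzDr // -[(- 1) ^ - (i : int)]exprz_inv invrN1.
- by move=> i j [].
- move=> [[a' b'] c'] /=; rewrite /coef_subX.
  have [aa'|_] := eqVneq (a - a') 0; last by rewrite scaler0.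
  case: andP => [[c0 /eqP e]|_]; last by rewrite mulr0 scale0r.
  by move=> _; exists `|b'|%N; congr (_, _, _); lia.
Qed.

Lemma fseries3_mul_02 (V W : lmodType F) (Y : modes V V) (YW : modes V W)
    u v w a b c :
  fseries3_mul (@delta_10_2 F) (iterate_02 Y YW u v w) (a, b, c) =
  res02 (fun k l => YW (Y u k v) l w) (- b - 1) (- a - 1) (- c - 1).
Proof.
rewrite /fseries3_mul (@fsum_inj _ (fun i => (i%:Z, b, - 1 - b - i%:Z))).
- rewrite /res02 /expand; apply: eq_fsbigr => i _ /=.
  rewrite /coef_subX /expand_coef subrr eqxx absz_nat exp1rz expr1n !mul1r.
  (* The kernel contributes (-1)^i times the binomial of b + i over i, which is the binomial of - b
     - 1 over i. *)
  rewrite -(binomz_neg F (- b - 1)).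
  rewrite ifT; last by apply/andP; split => //; apply/eqP; lia.
  congr (_ * binomz F _ _ *: YW (Y u _ v) _ w); lia.
- by move=> i j [].
- move=> [[a' b'] c'] /=; rewrite /coef_subX.
  have [aa'|_] := eqVneq (b - b') 0; last by rewrite scaler0.
  case: andP => [[c0 /eqP e]|_]; last by rewrite scale0r.
  by move=> _; exists `|a'|%N; congr (_, _, _); lia.
Qed.

(** The map x -> - x - 1 between exponents and modes is an involution, so all coefficients
    correspond to all triples (m, k, l). *)
Lemma jacobi_borcherds (V W : lmodType F) (Y : modes V V) (YW : modes V W) :
  jacobi_identity Y YW <->
  forall u v w, borcherds (fun m l => YW u m (YW v l w))
    (fun m l => YW v l (YW u m w)) (fun k l => YW (Y u k v) l w).
Proof.
split=> [H u v w m k l|H u v w [[a b] c]].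
  have := H u v w (- k - 1, - m - 1, - l - 1).
  rewrite fseries3_mul_12 fseries3_mul_21 fseries3_mul_02.
  by have E (x : int) : - (- x - 1) - 1 = x by [lia]; rewrite !E.
by rewrite fseries3_mul_12 fseries3_mul_21 fseries3_mul_02; apply: H.
Qed.

End Borcherds.

(** * Jacobi triples: derivatives, and the unit in the first two slots *)

Section Residues.
Variables (F : numFieldType) (M : lmodType F).
Implicit Types (A B C : int -> int -> M) (m k l : int).

Let m1_neq0 : (- 1 : F) != 0.
Proof. by rewrite oppr_eq0 oner_eq0. Qed.

Let one_neq0 : (1 : F) != 0.
Proof. exact: oner_neq0. Qed.

(** Comes from x1 = x2 + (x1 - x2), and so is the same for all three residues. *)
Lemma res12_rec A m k l : truncated (fun l m => A m l) ->
  res12 A (m + 1) k l = res12 A m k (l + 1) + res12 A m (k + 1) l.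
Proof.
move=> tA; rewrite /res12 (expand_rec _ _ _ _ one_neq0 tA).
by lin_module F; ring.
Qed.

Lemma res21_rec B m k l : truncated B ->
  res21 B (m + 1) k l = res21 B m k (l + 1) + res21 B m (k + 1) l.
Proof.
move=> tB; rewrite /res21 (expand_rec _ _ _ _ m1_neq0 tB).
by lin_module F; ring.
Qed.

Lemma res02_rec C m k l : truncated C ->
  res02 C (m + 1) k l = res02 C m k (l + 1) + res02 C m (k + 1) l.
Proof.
move=> tC; rewrite /res02 (expand_rec _ _ _ _ one_neq0 tC).
by rewrite !scale1r.
Qed.

Lemma res12_derx A m k l : truncated (fun l m => A m l) ->
  res12 (fun m l => - m%:~R *: A (m - 1) l) m k l =
  - m%:~R *: res12 A (m - 1) k l - k%:~R *: res12 A m (k - 1) l.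
Proof.
by move=> tA; rewrite /res12 (expand_derivq _ _ _ _ _ tA) ?one_neq0 ?mul1r.
Qed.

Lemma res12_dery A m k l : truncated (fun l m => A m l) ->
  res12 (fun m l => - l%:~R *: A m (l - 1)) m k l =
  - l%:~R *: res12 A m k (l - 1) + k%:~R *: res12 A m (k - 1) l.
Proof.
move=> tA; rewrite /res12 (expand_derivp _ _ _ _ _ tA) ?one_neq0 //.
by lin_module F; ring.
Qed.

Lemma res21_derx B m k l : truncated B ->
  res21 (fun m l => - m%:~R *: B (m - 1) l) m k l =
  - m%:~R *: res21 B (m - 1) k l - k%:~R *: res21 B m (k - 1) l.
Proof. by move=> tB; rewrite /res21 (expand_derivp _ _ _ _ _ tB) ?mul1r. Qed.

Lemma res21_dery B m k l : truncated B ->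
  res21 (fun m l => - l%:~R *: B m (l - 1)) m k l =
  - l%:~R *: res21 B m k (l - 1) + k%:~R *: res21 B m (k - 1) l.
Proof.
move=> tB; rewrite /res21 (expand_derivq _ _ _ _ _ tB) //.
by lin_module F; ring.
Qed.

Lemma res02_derk C m k l : truncated C ->
  res02 (fun k l => - k%:~R *: C (k - 1) l) m k l =
  - k%:~R *: res02 C m (k - 1) l - m%:~R *: res02 C (m - 1) k l.
Proof.
by move=> tC; rewrite /res02 (expand_derivp _ _ _ _ _ tC) ?one_neq0 ?mul1r.
Qed.

Lemma res02_derl C m k l : truncated C ->
  res02 (fun k l => - l%:~R *: C k (l - 1)) m k l =
  - l%:~R *: res02 C m k (l - 1) - m%:~R *: res02 C (m - 1) k l.
Proof.
by move=> tC; rewrite /res02 (expand_derivq _ _ _ _ _ tC) ?one_neq0 ?mul1r.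
Qed.

(** The truncations are bundled in because [expand] takes the default value 0 on infinite supports
    and obeys its recurrence for truncated families. Each family is truncated in the index that its
    expansion raises. *)
Definition jacobi_triple A B C :=
  [/\ truncated (fun l m => A m l), truncated B, truncated C
    & borcherds A B C].

Lemma eq_jacobi_triple A B C A' B' C' :
  (forall m l, A m l = A' m l) -> (forall m l, B m l = B' m l) ->
  (forall k l, C k l = C' k l) -> jacobi_triple A' B' C' -> jacobi_triple A B C.
Proof.
move=> EA EB EC.
have -> : A = A' by apply/funext => m; apply/funext => l.
have -> : B = B' by apply/funext => m; apply/funext => l.
by have -> : C = C' by apply/funext => k; apply/funext => l.
Qed.

Lemma truncated_lin (G H : int -> int -> M) (c : F) :
  truncated G -> truncated H -> truncated (fun p q => c *: G p q + H p q).
Proof.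
move=> [N GN] [N' HN]; exists (Num.max N N') => p q.
by rewrite ge_max => /andP[Np N'p]; rewrite GN // HN // scaler0 addr0.
Qed.

Lemma truncated_derivp (G : int -> int -> M) :
  truncated G -> truncated (fun p q => - p%:~R *: G (p - 1) q).
Proof.
move=> [N GN]; exists (N + 1) => p q Np; rewrite GN ?scaler0 //; lia.
Qed.

Lemma truncated_derivq (G : int -> int -> M) :
  truncated G -> truncated (fun p q => - q%:~R *: G p (q - 1)).
Proof. by move=> [N GN]; exists N => p q Np; rewrite GN ?scaler0. Qed.

Lemma jacobi_triple_lin (c : F) A B C A' B' C' :
  jacobi_triple A B C -> jacobi_triple A' B' C' ->
  jacobi_triple (fun m l => c *: A m l + A' m l)
    (fun m l => c *: B m l + B' m l) (fun k l => c *: C k l + C' k l).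
Proof.
move=> [tA tB tC J] [tA' tB' tC' J'].
split; [exact: truncated_lin tA tA'|exact: truncated_lin tB tB'|
  exact: truncated_lin tC tC'|].
move=> m k l; rewrite /res12 /res21 /res02.
rewrite (expand_lin _ _ _ _ _ _ tA tA') (expand_lin _ _ _ _ _ _ tB tB').
rewrite (expand_lin _ _ _ _ _ _ tC tC').
move: (J m k l) (J' m k l); rewrite /res12 /res21 /res02 => <- <-.
by lin_module F; ring.
Qed.

Lemma jacobi_triple_derx A B C : jacobi_triple A B C ->
  jacobi_triple (fun m l => - m%:~R *: A (m - 1) l)
    (fun m l => - m%:~R *: B (m - 1) l) (fun k l => - k%:~R *: C (k - 1) l).
Proof.
move=> [tA tB tC J]; split.
- exact: truncated_derivq tA.
- exact: truncated_derivp tB.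
- exact: truncated_derivp tC.
move=> m k l; rewrite res12_derx // res21_derx // res02_derk // -!J.
by lin_module F; ring.
Qed.

(** The third family stands for (a_k (Db))_l c, by a_k (Db) = D(a_k b) + k a_(k-1) b. *)
Lemma jacobi_triple_dery A B C : jacobi_triple A B C ->
  jacobi_triple (fun m l => - l%:~R *: A m (l - 1))
    (fun m l => - l%:~R *: B m (l - 1))
    (fun k l => - l%:~R *: C k (l - 1) + k%:~R *: C (k - 1) l).
Proof.
move=> [tA tB tC J].
have E : (fun k l => - l%:~R *: C k (l - 1) + k%:~R *: C (k - 1) l) =
    fun k l => (- 1 : F) *: (- k%:~R *: C (k - 1) l) + (- l%:~R *: C k (l - 1)).
  by apply/funext => k; apply/funext => l; lin_module F; ring.
have [tp tq] := (truncated_derivp tC, truncated_derivq tC).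
rewrite E; split.
- exact: truncated_derivp tA.
- exact: truncated_derivq tB.
- exact: truncated_lin tp tq.
move=> m k l; rewrite res12_dery // res21_dery //.
rewrite [RHS](expand_lin _ _ _ _ _ _ tp tq).
rewrite -/(res02 (fun k l => - k%:~R *: C (k - 1) l) m k l).
rewrite -/(res02 (fun k l => - l%:~R *: C k (l - 1)) m k l).
rewrite res02_derk // res02_derl // -!J.
by lin_module F; ring.
Qed.

(** For commuting products the two expansions agree when (x1 - x2)^k is a polynomial: they agree at
    k = 0, and the recurrence raises k. *)
Lemma res_comm_eq0 A m k l : truncated (fun l m => A m l) -> truncated A ->
  0 <= k -> res12 A m k l - res21 A m k l = 0.
Proof.
move=> tA tA' k0; move: k k0 m l; apply: int_up_ind => [m l|k _ IH m l].
  by rewrite /res12 /res21 !expand0 // subrr.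
have := IH (m + 1) l; rewrite res12_rec // res21_rec // opprD addrACA IH.
by rewrite add0r.
Qed.

(** The difference of the two residues satisfies the recurrence and vanishes for k >= 0, so by
    uniqueness it is the expansion of its values on the plane m = 0. *)
Lemma jacobi_triple_comm A C : truncated (fun l m => A m l) -> truncated A ->
  (forall k l, 0 <= k -> C k l = 0) ->
  (forall k l, k < 0 -> res12 A 0 k l - res21 A 0 k l = C k l) ->
  jacobi_triple A A C.
Proof.
move=> tA tA' C0 CE; split => //; first by exists 0 => k l; apply: C0.
move=> m k l; apply/esym; move: m k l.
apply: (expand_uniq (N := 0)) one_neq0 _ _ _ => [m k l|k l|m k l k0].
- rewrite res12_rec // res21_rec //; lin_module F; ring.
- have [k0|k0] := leP 0 k; first by rewrite res_comm_eq0 // C0.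
  exact: CE.
- exact: res_comm_eq0.
Qed.

Lemma res12_one A m k l :
  truncated (fun l m => A m l) -> (forall i : nat, (0 < i)%N -> A (m + k -
    i%:Z) (l + i%:Z) = 0) ->
  res12 A m k l = A (m + k) l.
Proof.
move=> tA A0; have [M' E] := expand_bound l tA.
rewrite /res12 (E M'.+1) ?leqnSn // big_ord_recl big1 => [|i _].
  rewrite expand_coef0 exp1rz scale1r /= addr0; congr (A _ _); lia.
by rewrite A0 ?scaler0.
Qed.

Lemma res21_eq0 B m k l :
  truncated B -> (forall i : nat, B (m + i%:Z) (l + k - i%:Z) = 0) ->
  res21 B m k l = 0.
Proof.
move=> tB B0; have [M' E] := expand_bound m tB.
by rewrite /res21 (E M') // big1 => // i _; rewrite B0 scaler0.
Qed.

Lemma jacobi_triple_one_l (g : int -> M) : (exists N, forall l, N <= l -> g l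
  = 0) ->
  jacobi_triple (fun m l => if m == - 1 then g l else 0)
    (fun m l => if m == - 1 then g l else 0)
    (fun k l => if k == - 1 then g l else 0).
Proof.
move=> [N gN].
have tA : truncated (fun l m : int => if m == - 1 then g l else 0).
  by exists N => l m /gN ->; case: ifP.
have tA' : truncated (fun m l : int => if m == - 1 then g l else 0).
  by exists 0 => m l m0; rewrite ifN //; lia.
apply: jacobi_triple_comm => // k l k0; first by rewrite ifN //; lia.
rewrite res12_one // => [|i i0]; last by rewrite ifN //; lia.
(* For m = 0 the modes m + i are nonnegative and never meet the mode -1 of the identity. *)
rewrite res21_eq0 //.
by rewrite subr0 add0r.
Qed.

(** For the identity in the second slot, the difference of the two residues is governed by a
    recursion in k, due to the vanishing derivative of the identity, and by its values at k = -1. *)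
Lemma res_one_m (g : int -> M) : (exists N, forall l, N <= l -> g l = 0) ->
  let A m l := if l == - 1 then g m else 0 in
  [/\ truncated (fun l m : int => A m l), truncated A,
     forall m k l, - l%:~R *: (res12 A m k (l - 1) - res21 A m k (l - 1)) =
                   - k%:~R *: (res12 A m (k - 1) l - res21 A m (k - 1) l)
   & forall l, res12 A 0 (- 1) l - res21 A 0 (- 1) l = g l].
Proof.
move=> [N gN] A.
have tA : truncated (fun l m : int => A m l).
  by exists 0 => l m l0; rewrite /A ifN //; lia.
have tA' : truncated A by exists N => l m /gN; rewrite /A => ->; case: ifP.
split=> // [m k l|l].
  have E : (fun m l : int => - l%:~R *: A m (l - 1)) = fun m l => 0.
    apply/funext => p; apply/funext => q; rewrite /A.
    have [e|_] := eqVneq (q - 1) (- 1); last by rewrite scaler0.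
    by have -> : q = 0 by [lia]; rewrite oppr0 scale0r.
  have := res12_dery m k l tA; have := res21_dery m k l tA'.
  rewrite E /res12 /res21 !expand_const0.
  move=> /esym/eqP; rewrite addr_eq0 => /eqP E1 /esym/eqP;
    rewrite addr_eq0 => /eqP E2.
  by rewrite !scalerBr E1 E2 !scaleNr.
(* For k = -1 the other term of the recurrence sits at k = 0 and vanishes; the difference then
   depends only on m + l and is read off at l = -1. *)
have J m l' : res12 A (m + 1) (- 1) l' - res21 A (m + 1) (- 1) l' =
    res12 A m (- 1) (l' + 1) - res21 A m (- 1) (l' + 1).
  rewrite res12_rec // res21_rec // opprD addrACA.
  have -> : (- 1 + 1 : int) = 0 by [].
  by rewrite (res_comm_eq0 _ _ tA tA' (lexx 0)) addr0.
have H s : res12 A s (- 1) (- 1) - res21 A s (- 1) (- 1) = g (s - 1).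
  rewrite res12_one // => [|i i0]; last by rewrite /A ifN //; lia.
  by rewrite res21_eq0 ?subr0 // => i; rewrite /A ifN //; lia.
have K (s m : int) : res12 A (s + m) (- 1) (- 1 - m) - res21 A (s + m) (- 1)
  (- 1 - m) = g (s - 1).
  case: (leP 0 m) => [|/ltW] m0; move: m m0.
    apply: int_up_ind => [|m _ <-]; first by rewrite addr0 subr0.
    have := J (s + m) (- 1 - (m + 1)); rewrite -addrA.
  by have -> : - 1 - (m + 1) + 1 = - 1 - m by [lia].
  apply: int_down_ind => [|m _ <-]; first by rewrite addr0 subr0.
  have := J (s + m) (- 1 - (m + 1)); rewrite -addrA.
  by have -> : - 1 - (m + 1) + 1 = - 1 - m by [lia] => ->.
have := K (l + 1) (- (l + 1)); rewrite subrr addrK.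
by have -> : - 1 - - (l + 1) = l by [lia].
Qed.

(** [C] and the difference of residues agree at k = -1 and obey the same recursion, which lowers k
    as its factor k + 1 is nonzero for k < -1. *)
Lemma jacobi_triple_one_m (g : int -> M) C :
  (exists N, forall l, N <= l -> g l = 0) ->
  (forall k l, 0 <= k -> C k l = 0) -> (forall l, C (- 1) l = g l) ->
  (forall k l, - k%:~R *: C (k - 1) l = - l%:~R *: C k (l - 1)) ->
  jacobi_triple (fun m l => if l == - 1 then g m else 0)
    (fun m l => if l == - 1 then g m else 0) C.
Proof.
move=> gN C0 C1 CD; have [tA tA' AD A1] := res_one_m gN.
apply: jacobi_triple_comm => // k l k0.
have {k0} k1 : k <= - 1 by lia.
move: k k1 l; apply: int_down_ind => [l|k k1 IH l]; first by rewrite A1 C1.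
have k0 : - (k + 1)%:~R != 0 :> F by rewrite oppr_eq0 intr_eq0; lia.
apply: (scalerI k0); have := CD (k + 1) l; rewrite addrK => ->.
by rewrite -IH AD addrK.
Qed.

End Residues.

Lemma jacobi_triple_map (F : numFieldType) (M M' : lmodType F)
    (f : {linear M -> M'}) (A B C : int -> int -> M) :
  jacobi_triple A B C ->
  jacobi_triple (fun m l => f (A m l)) (fun m l => f (B m l))
    (fun k l => f (C k l)).
Proof.
have tf (G : int -> int -> M) : truncated G -> truncated (fun p q => f (G p q)).
  by move=> [N GN]; exists N => p q /GN ->; rewrite linear0.
move=> [tA tB tC J]; split; [exact: tf tA|exact: tf tB|exact: tf tC|].
move=> m k l; rewrite /res12 /res21 /res02.
rewrite (expand_map f _ _ _ _ _ tA) (expand_map f _ _ _ _ _ tB).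
by rewrite (expand_map f _ _ _ _ _ tC) -linearB; congr (f _); apply: J.
Qed.

(** * The Jacobi identity with the unit in the third slot *)

Section RightUnit.
Variables (F : numFieldType) (M : lmodType F) (D : {linear M -> M}).
Variables A B C : int -> int -> M.
Hypotheses (tA : truncated (fun l m => A m l)) (tB : truncated B)
  (tC : truncated C).
Hypotheses (A0 : forall m l, 0 <= l -> A m l = 0)
  (B0 : forall m l, 0 <= m -> B m l = 0)
  (C0 : forall k l, 0 <= l -> C k l = 0).
Hypotheses
  (DA : forall m l,
     D (A m l) = - m%:~R *: A (m - 1) l + - l%:~R *: A m (l - 1))
  (DB : forall m l,
     D (B m l) = - m%:~R *: B (m - 1) l + - l%:~R *: B m (l - 1))
  (DC : forall k l, D (C k l) = - l%:~R *: C k (l - 1)).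
Hypotheses (AC : forall m, A m (- 1) = C m (- 1))
  (skew : forall k, (- 1) ^ k *: B (- 1) k = - res02 C (- 1) k 0).

(* The conditions at [l = -1] and the skew symmetry give [X] = 0 on parts of
   the lines [l = -1] and [m = -1]. The action of [D] propagates this to the
   half-spaces [0 <= m] and [0 <= l], and the recurrence to the rest. *)
Let X m k l := res12 A m k l - res21 B m k l - res02 C m k l.

Let X_rec m k l : X (m + 1) k l = X m k (l + 1) + X m (k + 1) l.
Proof.
by rewrite /X res12_rec // res21_rec // res02_rec //; lin_module F; ring.
Qed.

Let X_deriv m k l :
  D (X m k l) = - m%:~R *: X (m - 1) k l - l%:~R *: X m k (l - 1).
Proof.
rewrite /X ![D (_ - _)]linearB -[D (res12 _ _ _ _)](expand_map D _ _ _ _ _ tA).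
rewrite -[D (res21 _ _ _ _)](expand_map D _ _ _ _ _ tB).
rewrite -[D (res02 _ _ _ _)](expand_map D _ _ _ _ _ tC).
have EA := res12_derx m k l tA; have EA' := res12_dery m k l tA.
have EB := res21_derx m k l tB; have EB' := res21_dery m k l tB.
have EC := res02_derl m k l tC.
have tAx : truncated (fun l m =>
  - m%:~R *: A (m - 1) l) by exact: truncated_derivq tA.
have tAy : truncated (fun l m =>
  - l%:~R *: A m (l - 1)) by exact: truncated_derivp tA.
have tBx : truncated (fun m l =>
  - m%:~R *: B (m - 1) l) by exact: truncated_derivp tB.
have tBy : truncated (fun m l =>
  - l%:~R *: B m (l - 1)) by exact: truncated_derivq tB.
have DA1 q p : D (A p q) = 1 *: (- p%:~R *: A (p - 1) q) + - q%:~R *: A p (q -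
  1).
  by rewrite DA scale1r.
have DB1 p q : D (B p q) = 1 *: (- p%:~R *: B (p - 1) q) + - q%:~R *: B p (q -
  1).
  by rewrite DB scale1r.
rewrite (eq_expand _ _ DA1) (eq_expand _ _ DB1) (eq_expand _ _ DC).
rewrite (expand_lin _ _ _ _ _ _ tAx tAy) (expand_lin _ _ _ _ _ _ tBx tBy).
rewrite /res12 /res21 /res02 in EA EA' EB EB' EC *.
rewrite EA EA' EB EB' EC.
by lin_module F; ring.
Qed.

Let C_eq0 m k l : 0 <= m -> 0 <= l -> res02 C m k l = 0.
Proof.
move=> m0; move: m m0 k l; apply: int_up_ind => [k l l0|m _ IH k l l0].
  by rewrite /res02 expand0 // C0.
by rewrite res02_rec // !IH ?addr0 //; lia.
Qed.

Let A_eq0 m k l : 0 <= l -> res12 A m k l = 0.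
Proof. by apply: expand_eq0 => p q; apply: A0. Qed.

Let B_eq0 m k l : 0 <= m -> res21 B m k l = 0.
Proof. by apply: expand_eq0 => p q; apply: B0. Qed.

Let X_ge0 m k l : 0 <= m -> 0 <= l -> X m k l = 0.
Proof. by move=> m0 l0; rewrite /X A_eq0 // B_eq0 // C_eq0 // !subr0. Qed.

Let X_m1 m k : 0 <= m -> X m k (- 1) = 0.
Proof.
move=> m0; move: m m0 k; apply: int_up_ind => [k|m m0 IH k]; last first.
  by rewrite X_rec IH X_ge0 // addr0.
rewrite /X B_eq0 // res12_one // => [|i i0]; last by rewrite A0 //; lia.
by rewrite /res02 expand0 // add0r AC subr0 subrr.
Qed.

Let X_m_ge0 m k l : 0 <= m -> X m k l = 0.
Proof.
move=> m0; have [l0|l0] := leP 0 l; first exact: X_ge0.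
have {l0} l1 : l <= - 1 by lia.
move: l l1 m m0 k; apply: int_down_ind => [m m0 k|l l1 IH m m0 k].
  exact: X_m1.
have l0 : (l + 1)%:~R != 0 :> F by rewrite intr_eq0; lia.
(* The term with coefficient m drops out: either m = 0, or m - 1 is still nonnegative and the
   induction applies. What is left is (l + 1) X m k l with l + 1 < 0. *)
have := X_deriv m k (l + 1); rewrite addrK IH // linear0.
have -> : - m%:~R *: X (m - 1) k (l + 1) = 0.
  have [->|mn0] := eqVneq m 0; first by rewrite oppr0 scale0r.
  by rewrite IH ?scaler0 //; lia.
by rewrite sub0r => /esym/eqP; rewrite oppr_eq0 scaler_eq0 (negPf l0) => /eqP.
Qed.

Let res21_m1 k : res21 B (- 1) k 0 = (- 1) ^ k *: B (- 1) k.
Proof.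
have [M' E] := expand_bound (- 1) tB.
rewrite /res21 (E M'.+1) ?leqnSn // big_ord_recl big1 => [|i _].
  by rewrite expand_coef0 addr0; congr (_ *: B _ _); rewrite /=; lia.
by rewrite B0 ?scaler0 // lift0; lia.
Qed.

Let X_l_ge0 m k l : 0 <= l -> X m k l = 0.
Proof.
move=> l0; have [m0|m0] := leP 0 m; first exact: X_m_ge0.
have {m0} m1 : m <= - 1 by lia.
move: m m1 k l l0; apply: int_down_ind => [k l l0|m m1 IH k l l0].
  (* On the line m = -1, skew symmetry is the case l = 0, and the recurrence together with X 0 k l =
     0 raises l. *)
  move: l l0 k; apply: int_up_ind => [k|l l0 IH k].
    by rewrite /X A_eq0 // res21_m1 skew opprK add0r subrr.
  by have := X_rec (- 1) k l; rewrite IH addr0 => <-; apply: X_m_ge0.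
have m0 : (m + 1)%:~R != 0 :> F by rewrite intr_eq0; lia.
have := X_deriv (m + 1) k l; rewrite addrK IH // linear0.
have -> : l%:~R *: X (m + 1) k (l - 1) = 0.
  have [->|ln0] := eqVneq l 0; first by rewrite scale0r.
  by rewrite IH ?scaler0 //; lia.
by rewrite subr0 scaleNr => /esym/eqP;
  rewrite oppr_eq0 scaler_eq0 (negPf m0) => /eqP.
Qed.

Lemma jacobi_triple_one_r : jacobi_triple A B C.
Proof.
split => // m k l; apply/subr0_eq; rewrite -/(X m k l).
have [m0|/ltW m0] := leP 0 m; first exact: X_m_ge0.
move: m m0 k l; apply: int_down_ind => [k l|m _ IHm k l]; first exact: X_m_ge0.
have [l0|/ltW l0] := leP 0 l; first exact: X_l_ge0.
move: l l0 k; apply: int_down_ind => [k|l _ IHl k]; first exact: X_l_ge0.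
(* The recurrence at k - 1 expresses X m k l by values at m + 1 and at l + 1. *)
by have := X_rec m (k - 1) l; rewrite subrK IHm IHl add0r => <-.
Qed.

End RightUnit.

(** * Fields on [W] and their n-th products *)

Section Fields.
Variables (F : numFieldType) (W : lmodType F).

(** All families of maps, with the pointwise linear structure; linearity and lower truncation are
    the separate predicate [is_field]. *)
Definition field := int -> W -> W.
HB.instance Definition _ := GRing.Lmodule.on field.

Implicit Types (a b c : field) (m n k l : int) (w : W).

Definition is_field a := (forall n, linear (a n)) /\
  forall w, exists N : int, forall n, N <= n -> a n w = 0.

Definition field1 : field := fun n w => if n == - 1 then w else 0.

Definition field_deriv a : field := fun n w => - n%:~R *: a (n - 1) w.

Lemma field_deriv_linear : linear field_deriv.
Proof.
move=> c a b; apply/funext => n; apply/funext => w.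
rewrite /field_deriv !fctE.
by lin_module F; ring.
Qed.
HB.instance Definition _ :=
  GRing.isLinear.Build F field field _ field_deriv field_deriv_linear.

Lemma is_field_lin (x : F) a b :
  is_field a -> is_field b -> is_field (x *: a + b).
Proof.
move=> [La Ta] [Lb Tb]; split=> [n y u v|w].
  rewrite !fctE La Lb; lin_module F; ring.
have [N aN] := Ta w; have [N' bN] := Tb w.
exists (Num.max N N') => n; rewrite ge_max => /andP[? ?].
by rewrite !fctE aN // bN // scaler0 addr0.
Qed.

Lemma is_field0 : is_field 0.
Proof. by split=> [n y u v|w]; [rewrite scaler0 addr0|exists 0]. Qed.

Lemma is_field1 : is_field field1.
Proof.
split=> [n y u v|w]; rewrite /field1; first by case: ifP;
  rewrite ?scaler0 ?addr0.
by exists 0 => n n0; rewrite ifN //; lia.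
Qed.

Lemma is_field_deriv a : is_field a -> is_field (field_deriv a).
Proof.
move=> [La Ta]; split=> [n y u v|w].
  by rewrite /field_deriv La; lin_module F; ring.
have [N aN] := Ta w; exists (N + 1) => n Nn.
by rewrite /field_deriv aN ?scaler0 //; lia.
Qed.

Lemma is_field_0r a n : is_field a -> a n 0 = 0.
Proof.
by move=> [La _]; have := La n (- 1) 0 0; rewrite scaler0 addr0 scaleN1r addNr.
Qed.

Lemma is_fieldZ a n x w : is_field a -> a n (x *: w) = x *: a n w.
Proof.
by move=> fa; have [La _] := fa; have := La n x w 0;
  rewrite !addr0 is_field_0r // addr0.
Qed.

Lemma truncated_comp a b w : is_field a -> is_field b ->
  truncated (fun l m => a m (b l w)).
Proof.
move=> fa [_ Tb]; have [N bN] := Tb w; exists N => l m Nl.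
by rewrite bN // is_field_0r.
Qed.

(* The modes of Res_{x1} ((x1 - x2)^n a(x1) b(x2) - (- x2 + x1)^n b(x2) a(x1)),
   the [n]-th product of the fields [a] and [b]. *)
Definition field_prod a n b : field := fun l w =>
  res12 (fun m l => a m (b l w)) 0 n l - res21 (fun m l => b l (a m w)) 0 n l.


Lemma field_prod_linl n b x a a' : is_field a -> is_field a' -> is_field b ->
  field_prod (x *: a + a') n b = x *: field_prod a n b + field_prod a' n b.
Proof.
move=> fa fa' fb; apply/funext => l; apply/funext => w.
have E1 := expand_lin 1 (- 1) x n l 0 (truncated_comp w fa fb) (truncated_comp
  w fa' fb).
have E2 := expand_lin (- 1) 1 x n 0 l (truncated_comp w fb fa) (truncated_comp
  w fb fa').
rewrite !fctE {1}/field_prod {1}/res12 {1}/res21 E1.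
rewrite (@eq_expand _ _ (- 1) 1 _ (fun m l =>
  x *: b l (a m w) + b l (a' m w))); last first.
  by move=> p q; case: fb => Lb _; apply: Lb.
by rewrite E2 /field_prod /res12 /res21; lin_module F; ring.
Qed.

Lemma field_prod_linr n a x b b' : is_field b -> is_field b' -> is_field a ->
  field_prod a n (x *: b + b') = x *: field_prod a n b + field_prod a n b'.
Proof.
move=> fb fb' fa; apply/funext => l; apply/funext => w.
have E1 := expand_lin 1 (- 1) x n l 0 (truncated_comp w fa fb) (truncated_comp
  w fa fb').
have E2 := expand_lin (- 1) 1 x n 0 l (truncated_comp w fb fa) (truncated_comp
  w fb' fa).
rewrite !fctE {1}/field_prod {1}/res12 {1}/res21 E2.
rewrite (@eq_expand _ _ 1 (- 1) _ (fun l m =>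
  x *: a m (b l w) + a m (b' l w))); last first.
  by move=> p q; case: fa => La _; apply: La.
by rewrite E1 /field_prod /res12 /res21; lin_module F; ring.
Qed.

Lemma field_prod0l n b : is_field b -> field_prod 0 n b = 0.
Proof.
move=> fb; have := field_prod_linl n (- 1) is_field0 is_field0 fb.
by rewrite scaler0 addr0 scaleN1r addNr.
Qed.

Lemma field_prod0r a n : is_field a -> field_prod a n 0 = 0.
Proof.
move=> fa; have := field_prod_linr n (- 1) is_field0 is_field0 fa.
by rewrite scaler0 addr0 scaleN1r addNr.
Qed.

Lemma field_prodZl a n b (x : F) : is_field a -> is_field b ->
  field_prod (x *: a) n b = x *: field_prod a n b.
Proof.
move=> fa fb; have := field_prod_linl n x fa is_field0 fb.
by rewrite !addr0 field_prod0l // addr0.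
Qed.

Lemma field_prodZr a n b (x : F) : is_field a -> is_field b ->
  field_prod a n (x *: b) = x *: field_prod a n b.
Proof.
move=> fa fb; have := field_prod_linr n x fb is_field0 fa.
by rewrite !addr0 field_prod0r // addr0.
Qed.

(** Integration by parts in x1; at m = 0 the term with coefficient m drops out. *)
Lemma field_prod_derivl a n b : is_field a -> is_field b ->
  field_prod (field_deriv a) n b = - n%:~R *: field_prod a (n - 1) b.
Proof.
move=> fa fb; apply/funext => l; apply/funext => w.
have E1 := res12_derx 0 n l (truncated_comp w fa fb).
have E2 := res21_derx 0 n l (truncated_comp w fb fa).
rewrite !fctE {1}/field_prod E1.
rewrite /res21 (@eq_expand _ _ (- 1) 1 _ (fun m l =>
  - m%:~R *: b l (a (m - 1) w))); last first.
  by move=> p q; rewrite /field_deriv is_fieldZ.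
rewrite -/(res21 _ 0 n l) E2 /field_prod.
by lin_module F; ring.
Qed.

(** The operator d/dx1 + d/dx2 kills (x1 - x2)^n, so the two terms with coefficient n cancel. *)
Lemma field_deriv_prod a n b : is_field a -> is_field b ->
  field_deriv (field_prod a n b) =
  field_prod (field_deriv a) n b + field_prod a n (field_deriv b).
Proof.
move=> fa fb; rewrite field_prod_derivl //; apply/funext => l;
  apply/funext => w.
have E1 := res12_dery 0 n l (truncated_comp w fa fb).
have E2 := res21_dery 0 n l (truncated_comp w fb fa).
rewrite !fctE [in RHS]/field_prod [X in _ = _ + (_ - X)]E2.
rewrite [X in _ = _ + (X - _)]/res12 (@eq_expand _ _ 1 (- 1) _ (fun l m =>
  - l%:~R *: a m (b (l - 1) w))); last first.
  by move=> p q; rewrite /field_deriv is_fieldZ.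
rewrite -/(res12 _ 0 n l) E1 /field_deriv /field_prod.
by lin_module F; ring.
Qed.

Lemma field_prod_derivr a n b : is_field a -> is_field b ->
  field_prod a n (field_deriv b) =
  field_deriv (field_prod a n b) + n%:~R *: field_prod a (n - 1) b.
Proof.
move=> fa fb; rewrite field_deriv_prod // field_prod_derivl //.
by lin_module F; ring.
Qed.

(** The Jacobi identity for the identity in the first slot, read at m = 0, where [res02] returns the
    family itself. *)
Lemma field_prod1l n b : is_field b ->
  field_prod field1 n b = if n == - 1 then b else 0.
Proof.
move=> fb; apply/funext => l; apply/funext => w.
have := @jacobi_triple_one_l F W (fun l => b l w) (proj2 fb w).
move=> [tA tB tC /(_ 0 n l)].
rewrite /res02 expand0 // => E.
transitivity (if n == - 1 then b l w else 0); last by case: ifP.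
rewrite -E /field_prod /res12 /res21; congr (_ - _).
congr (expand _ _ _ _ _ _); apply/funext => p; apply/funext => q.
by rewrite /field1; case: ifP => // _; rewrite is_field_0r.
Qed.

Let field_res_one a w : is_field a ->
  (fun m l => a m (field1 l w)) = (fun m l => if l == - 1 then a m w else 0)
  /\ forall n l, field_prod a n field1 l w =
  res12 (fun m l => if l == - 1 then a m w else 0) 0 n l -
  res21 (fun m l => if l == - 1 then a m w else 0) 0 n l.
Proof.
move=> fa.
have E : (fun m l => a m (field1 l w)) = (fun m l =>
  if l == - 1 then a m w else 0).
  apply/funext => p; apply/funext => q.
  by rewrite /field1; case: ifP => // _; rewrite is_field_0r.
by split=> // n l; rewrite /field_prod E.
Qed.

Lemma field_prod1r_ge0 a n : is_field a -> 0 <= n -> field_prod a n field1 = 0.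
Proof.
move=> fa n0; apply/funext => l; apply/funext => w.
have [_ ->] := field_res_one w fa; have [tA tA' _ _] := res_one_m (proj2 fa w).
exact: res_comm_eq0.
Qed.

Lemma field_prod1r a : is_field a -> field_prod a (- 1) field1 = a.
Proof.
move=> fa; apply/funext => l; apply/funext => w.
by have [_ ->] := field_res_one w fa; have [_ _ _ ->] := res_one_m (proj2 fa w).
Qed.

Lemma field_deriv1 : field_deriv field1 = 0.
Proof.
apply/funext => n; apply/funext => w; rewrite /field_deriv /field1.
have [e|_] := eqVneq (n - 1) (- 1); last by rewrite scaler0.
by have -> : n = 0 by [lia]; rewrite oppr0 scale0r.
Qed.

End Fields.

(** * The products a_n 1 with the identity field *)

Section UnitProducts.
Variables (F : numFieldType) (W : lmodType F).
Implicit Types (a b c : field W).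

(** Both sides are (Da)_n 1, the right one by the derivation rule and D1 = 0, with D for
    [field_deriv]. *)
Lemma field_prod1r_rec a n : is_field a ->
  - n%:~R *: field_prod a (n - 1) (@field1 F W) =
  field_deriv (field_prod a n (@field1 F W)).
Proof.
move=> fa; rewrite field_deriv_prod //; last exact: is_field1.
rewrite field_prod_derivl //; last exact: is_field1.
by rewrite field_deriv1 field_prod0r // addr0.
Qed.

(** This is a_(-1-i) 1 = D^i a / i!, written out at mode p. *)
Lemma field_prod1rE a (i : nat) p w : is_field a ->
  field_prod a (- 1 - i%:Z) (@field1 F W) p w =
  ((- 1) ^+ i * binomz F p i) *: a (p - i%:Z) w.
Proof.
move=> fa; elim: i p => [|i IH] p.
  by rewrite subr0 field_prod1r // binomz_n0 mulr1 scale1r subr0.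
have i0 : (i.+1%:R : F) != 0 by rewrite pnatr_eq0.
apply: (scalerI i0).
have := congr1 (fun f : field W => f p w) (field_prod1r_rec (- 1 - i%:Z) fa).
rewrite [field_deriv _ _ _]/field_deriv IH !fctE.
have -> : - 1 - i%:Z - 1 = - 1 - i.+1%:Z by lia.
have -> : p - 1 - i%:Z = p - i.+1%:Z by lia.
have -> : - (- 1 - i%:Z)%:~R = i.+1%:R :> F.
  by rewrite rmorphB rmorphN1 /= opprB opprK -natr1.
move=> ->; rewrite !scalerA; congr (_ *: _).
have := binomz_absorb F (p - 1) i; rewrite subrK exprS intrB subrK => E.
transitivity (- (- 1) ^+ i * (p%:~R * binomz F (p - 1) i)); first by ring.
by rewrite -E; ring.
Qed.

End UnitProducts.

(** * Closure and Jacobi identity for the fields generated by a module *)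

Section GeneratedAlgebra.
Variables (F : numFieldType) (V W : lmodType F) (Y : modes V V)
  (YW : V -> field W).

(** Closure under n-th products is not a constructor but a consequence, [generated_prod], so
    inductions have four cases. *)
Inductive generated : field W -> Prop :=
  | generated_field v : generated (YW v)
  | generated1 : generated (@field1 F W)
  | generated_deriv a : generated a -> generated (field_deriv a)
  | generated_lin (x : F) a b :
      generated a -> generated b -> generated (x *: a + b).

Hypotheses (VY : is_vertex_leibniz Y) (MW : is_module Y YW).

Let module_field v : is_field (YW v).
Proof. by case: MW => [[_ L T] _]; split => [n|w]; [apply: L|apply: T]. Qed.

Let module_res u v w m k l :
  res12 (fun m l => YW u m (YW v l w)) m k l -
  res21 (fun m l => YW v l (YW u m w)) m k l =
  res02 (fun k l => YW (Y u k v) l w) m k l.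
Proof. by case: MW => _ /jacobi_borcherds; apply. Qed.

Let YW0 : YW 0 = 0.
Proof.
case: MW => [[L _ _] _]; apply/funext => n; apply/funext => w.
by have := L n w (- 1) 0 0; rewrite scaler0 addr0 scaleN1r addNr.
Qed.

Let module_trunc u v w : truncated (fun k l => YW (Y u k v) l w).
Proof.
by case: VY => [[_ _ /(_ u v)[N YN]] _]; exists N => k l /YN ->; rewrite YW0.
Qed.

(** The case m = 0 of the Jacobi identity of the module. *)
Lemma module_prod u n v : field_prod (YW u) n (YW v) = YW (Y u n v).
Proof.
apply/funext => l; apply/funext => w; rewrite /field_prod module_res.
by rewrite /res02 expand0.
Qed.

Let prod_truncated u v c : is_field c ->
  truncated (fun k l => field_prod (field_prod (YW u) k (YW v)) l c).
Proof.
case: VY => [[_ _ /(_ u v)[N YN]] _] fc; exists N => k l /YN E.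
by rewrite module_prod E YW0 field_prod0l.
Qed.

(** Skew symmetry: v_k u is the sum over i of (-1)^(k+i+1) D^i(u_(k+i) v) / i!. At mode p it is the
    Jacobi identity of the module at (p, k, 0). *)
Let module_skew u v k : (- 1) ^ k *: field_prod (YW v) k (YW u) =
  - res02 (fun k l => field_prod (field_prod (YW u) k (YW v)) l (@field1 F W))
      (- 1) k 0.
Proof.
have t := prod_truncated u v (is_field1 W).
apply/funext => p; apply/funext => w.
have [M1 E1] := expand_bound k t.
have [M2 E2] := expand_bound k (module_trunc u v w).
have -> : (- res02 (fun k l => field_prod (field_prod (YW u) k (YW v)) l
    (@field1 F W)) (- 1) k 0) p w =
    - res02 (fun k l => YW (Y u k v) l w) p k 0.
  (* One expansion lives in the space of fields and the other in [W]; a common cutoff lets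
     evaluation at p and w pass through the sum. *)
  rewrite /res02 (E1 (maxn M1 M2)) ?leq_maxl // (E2 (maxn M1 M2)) ?leq_maxr //.
  rewrite -[LHS]/(- ((\sum_(i < maxn M1 M2) _) p w)); congr (- _).
  rewrite !fct_sumE; apply: eq_bigr => i _; rewrite !fctE.
  rewrite module_prod /expand_coef !exp1rz !expr1n !mul1r binomz_m1 sub0r add0r.
  by rewrite field_prod1rE // scalerA mulrA -expr2 sqrr_sign mul1r.
rewrite -module_res opprB.
rewrite -[LHS]/((- 1) ^ k *: (field_prod (YW v) k (YW u) p w)).
rewrite /field_prod scalerBr /res12 /res21.
have o10 : (1 : F) != 0 by exact: oner_neq0.
(* Exchanging u and v swaps the two products and replaces (x1 - x2)^k by (x2 - x1)^k, hence the
   factor (-1)^k. *)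
rewrite -(expandN _ _ _ _ o10 (truncated_comp w (module_field v) (module_field
  u))).
have m10 : (- 1 : F) != 0 by rewrite oppr_eq0 oner_eq0.
rewrite -(expandN _ _ _ _ m10 (truncated_comp w (module_field u) (module_field
  v))).
by rewrite !opprK.
Qed.

Lemma generated_is_field a : generated a -> is_field a.
Proof.
elim=> [v||b _|x b c _ fb _ fc]; [exact: module_field|exact: is_field1|
  exact: is_field_deriv|exact: is_field_lin].
Qed.

#[local] Hint Resolve is_field1 module_field : core.

Lemma generated0 : generated 0.
Proof.
by rewrite -[0](addNr (@field1 F W)) -scaleN1r;
  apply: generated_lin generated1 _; apply: generated1.
Qed.

Lemma generatedZ x a : generated a -> generated (x *: a).
Proof.
by move=> ga; rewrite -[_ *: _]addr0; apply: generated_lin ga generated0.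
Qed.

(** Induction on [a], then on [b]: every constructor has a product rule, and two generators multiply
    by [module_prod]. *)
Lemma generated_prod a n b : generated a -> generated b ->
  generated (field_prod a n b).
Proof.
move=> ga; elim: ga n b => [u||a' ga' IH|x a1 a2 ga1 IH1 ga2 IH2] n b gb;
  have fb := generated_is_field gb; last 3 first.
- rewrite field_prod1l //.
  by have [_|_] := eqVneq n (- 1); [|exact: generated0].
- have fa' := generated_is_field ga'; rewrite field_prod_derivl //.
  by apply: generatedZ; apply: IH.
- have [fa1 fa2] := (generated_is_field ga1, generated_is_field ga2).
  rewrite field_prod_linl //.
  by apply: generated_lin; [apply: IH1|apply: IH2].
elim: gb n => [v||b' gb' IH|x b1 b2 gb1 IH1 gb2 IH2] n.
- by rewrite module_prod; apply: generated_field.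
- have fu := module_field u.
  have [n0|n0] := leP 0 n; first by rewrite field_prod1r_ge0 //;
    apply: generated0.
  have {n0} n1 : n <= - 1 by lia.
  move: n n1; apply: int_down_ind => [|n n1 IH].
    by rewrite field_prod1r //; apply: generated_field.
  (* As n < -1, the product u_n 1 is a multiple of the derivative of u_(n+1) 1. *)
  have n0 : - (n + 1)%:~R != 0 :> F by rewrite oppr_eq0 intr_eq0; lia.
  have := field_prod1r_rec (n + 1) fu; rewrite addrK => E.
  rewrite -[X in generated X]scale1r -(mulVf n0) -scalerA E; apply: generatedZ.
  exact: generated_deriv.
- have fu := module_field u; have fb' := generated_is_field gb'.
  rewrite field_prod_derivr // addrC.
  by apply: generated_lin => //; apply: generated_deriv.
- have [fb1 fb2] := (generated_is_field gb1, generated_is_field gb2).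
  rewrite field_prod_linr //.
  exact: generated_lin.
Qed.

(** For two generators the bound is that of [Y] on [V]; a derivative raises it by one, and a linear
    combination takes the maximum. *)
Lemma generated_prod_truncated a b : generated a -> generated b ->
  exists N : int, forall n, N <= n -> field_prod a n b = 0.
Proof.
move=> ga; elim: ga b => [u||a' ga' IH|x a1 a2 ga1 IH1 ga2 IH2] b gb;
  have fb := generated_is_field gb; last 3 first.
- exists 0 => n n0; rewrite field_prod1l // ifN //; lia.
- have [N bN] := IH b gb; exists (N + 1) => n Nn.
  have fa' := generated_is_field ga'.
  by rewrite field_prod_derivl // bN ?scaler0 //; lia.
- have [[N1 bN1] [N2 bN2]] := (IH1 b gb, IH2 b gb).
  exists (Num.max N1 N2) => n; rewrite ge_max => /andP[? ?].
  have [fa1 fa2] := (generated_is_field ga1, generated_is_field ga2).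
  by rewrite field_prod_linl // bN1 // bN2 // scaler0 addr0.
elim: gb => [v||b' gb' [N bN]|x b1 b2 gb1 [N1 bN1] gb2 [N2 bN2]].
- case: VY => [[_ _ /(_ u v)[N YN]] _]; exists N => n /YN E.
  by rewrite module_prod E YW0.
- by exists 0 => n n0; rewrite field_prod1r_ge0.
- have fu := module_field u; have fb' := generated_is_field gb'.
  exists (N + 1) => n Nn.
  have := field_deriv_prod n fu fb'; rewrite field_prod_derivl //.
  rewrite !bN; [|lia|lia].
  by rewrite linear0 scaler0 add0r.
- exists (Num.max N1 N2) => n; rewrite ge_max => /andP[? ?].
  have [fb1 fb2] := (generated_is_field gb1, generated_is_field gb2).
  rewrite field_prod_linr //.
  by rewrite bN1 // bN2 // scaler0 addr0.
Qed.

Let generated_truncated a b c : generated a -> generated b -> generated c ->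
  truncated (fun l m => field_prod a m (field_prod b l c)).
Proof.
move=> ga gb gc; have [N E] := generated_prod_truncated gb gc;
  exists N => l m /E ->.
by rewrite field_prod0r //; apply: generated_is_field.
Qed.

Let generated_truncated02 a b c : generated a -> generated b -> generated c ->
  truncated (fun k l => field_prod (field_prod a k b) l c).
Proof.
move=> ga gb gc; have [N E] := generated_prod_truncated ga gb;
  exists N => k l /E ->.
by rewrite field_prod0l //; apply: generated_is_field.
Qed.

(** [YW] is linear and carries products in [V] to products of fields, so it transports the Jacobi
    identity of [V]. *)
Let jacobi_field3 u v w :
  jacobi_triple (fun m l => field_prod (YW u) m (field_prod (YW v) l (YW w)))
    (fun m l => field_prod (YW v) l (field_prod (YW u) m (YW w)))
    (fun k l => field_prod (field_prod (YW u) k (YW v)) l (YW w)).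
Proof.
have YWl : linear YW.
  by case: MW => [[L _ _] _] x v1 v2; apply/funext => n; apply/funext => z;
    apply: L.
pose f : {linear V -> field W} :=
  HB.pack YW (GRing.isLinear.Build F V (field W) _ YW YWl).
have [[L1 L2 T] /jacobi_borcherds J] := VY.
have Y0 a n : Y a n 0 = 0.
  by have := L2 a n (- 1) 0 0; rewrite scaler0 addr0 scaleN1r addNr.
have Y0' a n : Y 0 n a = 0.
  by have := L1 n a (- 1) 0 0; rewrite scaler0 addr0 scaleN1r addNr.
have JV : jacobi_triple (fun m l => Y u m (Y v l w))
    (fun m l => Y v l (Y u m w)) (fun k l => Y (Y u k v) l w).
  split => //.
  - by have [N E] := T v w; exists N => l m /E ->.
  - by have [N E] := T u w; exists N => m l /E ->.
  - by have [N E] := T u v; exists N => k l /E ->.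
by apply: eq_jacobi_triple (jacobi_triple_map f JV) => p q;
  rewrite !module_prod.
Qed.

(** The right unit case with D = [field_deriv], a derivation of all products, and with [module_skew]
    for the skew symmetry. *)
Let jacobi_field2_1 u v :
  jacobi_triple
    (fun m l => field_prod (YW u) m (field_prod (YW v) l (@field1 F W)))
    (fun m l => field_prod (YW v) l (field_prod (YW u) m (@field1 F W)))
    (fun k l => field_prod (field_prod (YW u) k (YW v)) l (@field1 F W)).
Proof.
have [[gu gv] g1] := (generated_field u, generated_field v, generated1).
have fp a b n (ga : generated a) (gb : generated b) : is_field (field_prod a n
  b).
  exact/generated_is_field/generated_prod.
apply: (@jacobi_triple_one_r _ _ (@field_deriv F W)).
- exact: generated_truncated.
- exact: (generated_truncated gv gu g1).
- exact: generated_truncated02.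
- by move=> m l l0; rewrite (field_prod1r_ge0 _ l0) ?field_prod0r.
- by move=> m l m0; rewrite (field_prod1r_ge0 _ m0) ?field_prod0r.
- by move=> k l l0; rewrite field_prod1r_ge0 //; apply: fp.
- move=> m l; rewrite /= field_deriv_prod ?field_prod_derivl //; try exact: fp.
  by rewrite -field_prod1r_rec // field_prodZr //; apply: fp.
- move=> m l; rewrite /= field_deriv_prod ?field_prod_derivl //; try exact: fp.
  by rewrite -field_prod1r_rec // field_prodZr 1?addrC //; apply: fp.
- by move=> k l; rewrite /= -field_prod1r_rec //; apply: fp.
- by move=> m; rewrite !field_prod1r //; apply: fp.
- by move=> k; rewrite field_prod1r // module_skew.
Qed.

(** The third argument is generalised first, while the other two are generators: the skew symmetry
    behind the case c = 1 is established for generators. *)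
Let generated_jacobi2 u v c : generated c ->
  jacobi_triple (fun m l => field_prod (YW u) m (field_prod (YW v) l c))
    (fun m l => field_prod (YW v) l (field_prod (YW u) m c))
    (fun k l => field_prod (field_prod (YW u) k (YW v)) l c).
Proof.
have [gu gv] := (generated_field u, generated_field v).
have fp a b n (ga : generated a) (gb : generated b) : is_field (field_prod a n
  b).
  exact/generated_is_field/generated_prod.
elim=> [w||c' gc IH|x c1 c2 gc1 IH1 gc2 IH2].
- exact: jacobi_field3.
- exact: jacobi_field2_1.
- have fc := generated_is_field gc.
  (* By the derivation rule, u_m v_l (Dc) = D(u_m v_l c) - (Du)_m v_l c - u_m (Dv)_l c; each term on
     the right is already a Jacobi triple. *)
  have J := jacobi_triple_lin (- 1) (jacobi_triple_derx IH)
    (jacobi_triple_lin (- 1) (jacobi_triple_dery IH)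
      (jacobi_triple_map (@field_deriv F W) IH)).
  apply: eq_jacobi_triple J => [m l|m l|k l].
  + rewrite field_prod_derivr // -[X in field_prod _ _ X]addrC.
    rewrite field_prod_linr ?field_prod_derivr //; try exact: fp.
      by rewrite /=; lin_module F; ring.
    exact/is_field_deriv/fp.
  + rewrite field_prod_derivr // -[X in field_prod _ _ X]addrC.
    rewrite field_prod_linr ?field_prod_derivr //; try exact: fp.
      by rewrite /=; lin_module F; ring.
    exact/is_field_deriv/fp.
  + rewrite field_prod_derivr //; last exact: fp.
    by rewrite /=; lin_module F; ring.
- have [f1 f2] := (generated_is_field gc1, generated_is_field gc2).
  apply: eq_jacobi_triple (jacobi_triple_lin x IH1 IH2) => [m l|m l|k l];
    by rewrite !field_prod_linr //; apply: fp.
Qed.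

Let generated_jacobi1 u b c : generated b -> generated c ->
  jacobi_triple (fun m l => field_prod (YW u) m (field_prod b l c))
    (fun m l => field_prod b l (field_prod (YW u) m c))
    (fun k l => field_prod (field_prod (YW u) k b) l c).
Proof.
have gu := generated_field u.
have fp a d n (ga : generated a) (gd : generated d) : is_field (field_prod a n
  d).
  exact/generated_is_field/generated_prod.
move=> gb gc; have fc := generated_is_field gc.
elim: gb => [v||b' gb IH|x b1 b2 gb1 IH1 gb2 IH2].
- exact: generated_jacobi2.
- have J := @jacobi_triple_one_m F (field W) (fun m => field_prod (YW u) m c)
    (fun k l => field_prod (field_prod (YW u) k (@field1 F W)) l c)
    (generated_prod_truncated gu gc).
  apply: eq_jacobi_triple (J _ _ _) => //.
  + move=> m l; rewrite (field_prod1l l fc).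
    by case: eqP => // _; rewrite field_prod0r.
  + by move=> m l; rewrite (field_prod1l l (fp _ _ m gu gc)).
  + by move=> k l k0; rewrite field_prod1r_ge0 // field_prod0l.
  + by move=> l; rewrite field_prod1r.
  (* Both sides of the recursion are (D(u_k 1))_l c. *)
  + have f1 n := fp _ _ n gu generated1.
    move=> k l; rewrite -(field_prodZl _ _ (f1 _) fc) field_prod1r_rec //.
    by rewrite (field_prod_derivl _ (f1 k) fc).
- have fb := generated_is_field gb.
  apply: eq_jacobi_triple (jacobi_triple_dery IH) => [m l|m l|k l].
  + by rewrite field_prod_derivl // field_prodZr //; apply: fp.
  + by rewrite field_prod_derivl //; apply: fp.
  + rewrite field_prod_derivr // -[X in field_prod X]addrC.
    rewrite field_prod_linl ?field_prod_derivl 1?addrC //; try exact: fp.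
    exact/is_field_deriv/fp.
- have [f1 f2] := (generated_is_field gb1, generated_is_field gb2).
  apply: eq_jacobi_triple (jacobi_triple_lin x IH1 IH2) => [m l|m l|k l].
  + by rewrite field_prod_linl // field_prod_linr //; apply: fp.
  + by rewrite field_prod_linl //; apply: fp.
  + by rewrite field_prod_linr // field_prod_linl //; apply: fp.
Qed.

Lemma generated_jacobi a b c : generated a -> generated b -> generated c ->
  jacobi_triple (fun m l => field_prod a m (field_prod b l c))
    (fun m l => field_prod b l (field_prod a m c))
    (fun k l => field_prod (field_prod a k b) l c).
Proof.
have fp d e n (gd : generated d) (ge : generated e) : is_field (field_prod d n
  e).
  exact/generated_is_field/generated_prod.
move=> ga gb gc.
have [fb fc] := (generated_is_field gb, generated_is_field gc).
elim: ga => [u||a' ga IH|x a1 a2 ga1 IH1 ga2 IH2].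
- exact: generated_jacobi1.
- have J := @jacobi_triple_one_l F (field W) (fun l => field_prod b l c)
    (generated_prod_truncated gb gc).
  apply: eq_jacobi_triple J => [m l|m l|k l].
  + by rewrite (field_prod1l m (fp _ _ l gb gc)).
  + by rewrite (field_prod1l m fc); case: eqP => // _; rewrite field_prod0r.
  + by rewrite (field_prod1l k fb); case: eqP => // _; rewrite field_prod0l.
- have fa := generated_is_field ga.
  apply: eq_jacobi_triple (jacobi_triple_derx IH) => [m l|m l|k l].
  + by rewrite field_prod_derivl //; apply: fp.
  + by rewrite field_prod_derivl // field_prodZr //; apply: fp.
  + by rewrite field_prod_derivl // field_prodZl //; apply: fp.
- have [f1 f2] := (generated_is_field ga1, generated_is_field ga2).
  apply: eq_jacobi_triple (jacobi_triple_lin x IH1 IH2) => [m l|m l|k l].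
  + by rewrite field_prod_linl //; apply: fp.
  + by rewrite field_prod_linl // field_prod_linr //; apply: fp.
  + by rewrite field_prod_linl // field_prod_linl //; apply: fp.
Qed.

End GeneratedAlgebra.

(** * The generated fields as a vector space *)

Section GeneratedSpace.
Variables (F : numFieldType) (V W : lmodType F) (YW : V -> field W).

Definition generated_pred : {pred field W} := fun a => `[< generated YW a >].

Lemma generatedP a : reflect (generated YW a) (a \in generated_pred).
Proof. exact: asboolP. Qed.

Lemma generated_submod_closed : submod_closed generated_pred.
Proof.
split=> [|x a b /generatedP ga /generatedP gb]; apply/generatedP.
  exact: generated0.
exact: generated_lin.
Qed.

HB.instance Definition _ :=
  GRing.isSubmodClosed.Build F (field W) generated_pred generated_submod_closed.

Record generated_space := GeneratedSpace {
  generated_val : field W;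
  _ : generated_val \in generated_pred }.

HB.instance Definition _ := [isSub for generated_val].
HB.instance Definition _ := [Choice of generated_space by <:].
HB.instance Definition _ := [SubChoice_isSubLmodule of generated_space by <:].

End GeneratedSpace.

(** * The vertex algebra of generated fields *)

Section GeneratedVertexAlgebra.
Variables (F : numFieldType) (V W : lmodType F) (Y : modes V V)
  (YW : V -> field W).
Hypotheses (VY : is_vertex_leibniz Y) (MW : is_module Y YW).

Local Notation K := (generated_space YW).

Let valK (a : K) : generated YW (val a).
Proof. by case: a => a /= /generatedP. Qed.

Let valf (a : K) : is_field (val a).
Proof. exact: (generated_is_field MW (valK a)). Qed.

Let prodK (a : K) n (b : K) : field_prod (val a) n (val b) \in generated_pred
  YW.
Proof. by apply/generatedP/(generated_prod VY MW). Qed.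

Let oneK : @field1 F W \in generated_pred YW.
Proof. exact/generatedP/generated1. Qed.

Let psiK v : YW v \in generated_pred YW.
Proof. exact/generatedP/generated_field. Qed.

Let YK : modes K K := fun a n b => GeneratedSpace (prodK a n b).

Let val_lin (x : F) (a b : K) : val (x *: a + b) = x *: val a + val b.
Proof. by rewrite linearP. Qed.

Let valL : {linear K -> field W} := \val.

Let truncated_val (G : int -> int -> K) :
  truncated (fun p q => val (G p q)) -> truncated G.
Proof.
move=> [N GN]; exists N => p q Np; apply: val_inj.
by rewrite GN // linear0.
Qed.

Let YK_vertex_map : is_vertex_map YK.
Proof.
split=> [n w x a b|a n x b c|a b].
- apply: val_inj; rewrite val_lin.
  rewrite -[LHS]/(field_prod (val (x *: a + b)) n (val w)) val_lin.
  exact: field_prod_linl.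
- apply: val_inj; rewrite val_lin.
  rewrite -[LHS]/(field_prod (val a) n (val (x *: b + c))) val_lin.
  exact: field_prod_linr.
- have [N E] := generated_prod_truncated VY MW (valK a) (valK b).
  by exists N => n /E En; apply: val_inj; rewrite linear0.
Qed.

(** The inclusion into all fields is linear and injective, and it commutes with truncated
    expansions, so the identity can be tested on fields. *)
Let YK_jacobi : jacobi_identity YK YK.
Proof.
apply/jacobi_borcherds => a b c m k l; apply: val_inj.
have [tA tB tC J] := generated_jacobi VY MW (valK a) (valK b) (valK c).
have tA' := @truncated_val (fun l m => YK a m (YK b l c)) tA.
have tB' := @truncated_val (fun m l => YK b l (YK a m c)) tB.
have tC' := @truncated_val (fun k l => YK (YK a k b) l c) tC.
rewrite [LHS](linearB valL) -[X in X - _](expand_map valL _ _ _ _ _ tA').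
rewrite -[X in _ - X](expand_map valL _ _ _ _ _ tB').
by rewrite -[RHS](expand_map valL _ _ _ _ _ tC'); apply: J.
Qed.

(** The embedding sends v to the field Y_W(v, x); its injectivity is the faithfulness of [W]. *)
Lemma faithful_module_embeds : injective YW -> embeds_in_vertex_algebra Y.
Proof.
move=> Yinj; exists K, YK, (GeneratedSpace oneK); split.
  split => //.
  - move=> n v; apply: val_inj => /=; rewrite (field_prod1l n (valf v)).
    by case: eqP => // _; rewrite linear0.
  - move=> v n n0; apply: val_inj; rewrite linear0 /=.
    exact: field_prod1r_ge0 (valf v) n0.
  - by move=> v; apply: val_inj; rewrite /= field_prod1r //; apply: valf.
have lin : linear (fun v => GeneratedSpace (psiK v) : K).
  move=> x u v; apply: val_inj; rewrite val_lin /=.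
  by case: MW => [[L _ _] _]; apply/funext => n; apply/funext => w; apply: L.
pose psi : {linear V -> K} := HB.pack (fun v => GeneratedSpace (psiK v) : K)
  (GRing.isLinear.Build F V K _ _ lin).
exists psi; split.
  by move=> u v /(congr1 val) /Yinj.
by move=> u v n; apply: val_inj; rewrite /= (module_prod VY MW).
Qed.

End GeneratedVertexAlgebra.

(** * The converse, and injectivity of the vertex operator map *)

Lemma vertex_algebra_faithful_module (F : numFieldType) (V : lmodType F)
    (Y : modes V V) :
  embeds_in_vertex_algebra Y -> admits_faithful_module Y.
Proof.
move=> [K [YK [one [[[[L1 L2 T] J] Y1 Yge0 Ym1] [psi [psiI psiY]]]]]].
(* [K] is a module over [V] through [psi]. It is faithful because the mode -1 of [psi u] applied to
   the unit gives back [psi u]. *)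
exists K, (fun v => YK (psi v)); split; last first.
  by move=> u v /(congr1 (fun f => f (- 1) one)); rewrite !Ym1 => /psiI.
split.
  split=> [n w x u v|v n|v w]; [|exact: L2|exact: T].
  by rewrite linearP L1.
apply/jacobi_borcherds => u v w m k l.
have := (jacobi_borcherds YK YK).1 J (psi u) (psi v) w m k l.
move=> ->; congr (res02 _ _ _ _); apply/funext => p; apply/funext => q.
by rewrite psiY.
Qed.

Lemma injective_modes (F : numFieldType) (V W : lmodType F) (Y : modes V W) :
  is_vertex_map Y ->
  injective Y <-> forall u, u <> 0 -> exists v n, Y u n v <> 0.
Proof.
move=> [L _ _]; split=> [Yinj u u0|H u v uv].
  apply: contrapT => H; apply: u0; apply: Yinj.
  have Y0 n w : Y 0 n w = 0.
    by have := L n w (- 1) 0 0; rewrite scaler0 addr0 scaleN1r addNr.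
  apply/funext => n; apply/funext => w; rewrite Y0.
  by apply: contrapT => E; apply: H; exists w, n.
apply: contrapT => /eqP; rewrite -subr_eq0 => /eqP /H [w [n]]; apply.
have := L n w (- 1) v u; rewrite !scaleN1r [- v + u]addrC => ->.
by rewrite uv addNr.
Qed.

Theorem proposition2p23 (R : realType) (V : lmodType R[i]) (Y : modes V V)
    (hV : is_vertex_leibniz Y) :
  (admits_faithful_module Y <-> embeds_in_vertex_algebra Y) /\
  (injective Y <->
     forall u : V, u <> 0 -> exists (v : V) (n : int), Y u n v <> 0) /\
  (injective Y -> embeds_in_vertex_algebra Y).
Proof.
split; [split=> [[W [YW [M Yinj]]]|]|split].
- exact: (faithful_module_embeds hV M).
- exact: vertex_algebra_faithful_module.
- by apply: injective_modes; case: hV.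
(* [V] is a module over itself, faithful when [Y] is injective. *)
- exact: (faithful_module_embeds hV hV).
Qed.
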